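(* Let $\mathcal{S}\subset\mathbb{R}^2$ be a nonempty closed and bounded set, and let $f:\mathbb{R}\to\mathbb{R}$ and $g:\mathbb{R}^2\to\mathbb{R}$ be continuous. For $\lambda\ge 0$ consider the optimization problem $$\max_{x,y}\{\lambda f(x)+g(x,y) : (x,y)\in\mathcal{S}\}.$$ If $f$ is strictly decreasing, then $\underline{x}^*(\lambda^1)\ge \overline{x}^*(\lambda^2)$ for all $0\le\lambda^1<\lambda^2$.
   Context: Superscripts on $\lambda$ are indices (two different values of $\lambda$), not powers. For $\lambda\ge 0$, $\mathcal{M}(\lambda)\subseteq\mathcal{S}$ denotes the set of all maximizers $(x,y)$ of the optimization problem, and $x^*(\lambda)=\{x : \exists y,\ (x,y)\in\mathcal{M}(\lambda)\}$ is its projection onto the $x$-component. This is a nonempty compact set, and one defines $\overline{x}^*(\lambda)=\max\{x : x\in x^*(\lambda)\}$ and $\underline{x}^*(\lambda)=\min\{x : x\in x^*(\lambda)\}$. *)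

(* Defs.v *)
From HB Require Import structures.
From mathcomp Require Import all_boot all_order all_algebra.
From mathcomp Require Import all_classical all_reals all_analysis.

Set Implicit Arguments.
Unset Strict Implicit.
Unset Printing Implicit Defensive.

Import Order.TTheory GRing.Theory Num.Theory.
Import numFieldNormedType.Exports.

Local Open Scope classical_set_scope.
Local Open Scope ring_scope.

Definition is_max (R : realType) (A : set R) (m : R) : Prop :=
  A m /\ forall x, A x -> x <= m.

Definition is_min (R : realType) (A : set R) (m : R) : Prop :=
  A m /\ forall x, A x -> m <= x.

(* Total operators: arbitrary values when the maximum (minimum) does not
   exist. *)
Definition setmax (R : realType) (A : set R) : R := get (is_max A).

Definition setmin (R : realType) (A : set R) : R := get (is_min A).

Definition objective (R : realType) (f : R -> R) (g : R * R -> R) (lambda : R)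
    (p : R * R) : R :=
  lambda * f p.1 + g p.

Definition maximizers (R : realType) (S : set (R * R)) (f : R -> R)
    (g : R * R -> R) (lambda : R) : set (R * R) :=
  [set p | S p /\
    forall q, S q -> objective f g lambda q <= objective f g lambda p].

Definition xstar (R : realType) (S : set (R * R)) (f : R -> R)
    (g : R * R -> R) (lambda : R) : set R :=
  [set x | exists y, maximizers S f g lambda (x, y)].

Definition xstar_max (R : realType) (S : set (R * R)) (f : R -> R)
    (g : R * R -> R) (lambda : R) : R :=
  setmax (xstar S f g lambda).

Definition xstar_min (R : realType) (S : set (R * R)) (f : R -> R)
    (g : R * R -> R) (lambda : R) : R :=
  setmin (xstar S f g lambda).

(* Main.v *)
(* If (x1, y1) and (x2, y2) are optimal for lambda1 < lambda2, adding the two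
   optimality inequalities cancels g and leaves
   (lambda2 - lambda1) * (f x2 - f x1) >= 0, so x2 <= x1 as f is strictly
   decreasing. Since xstar_max and xstar_min are arbitrary when the extremum is
   not attained, compactness of the set of maximizers is also needed. *)

Require Import Defs.
From HB Require Import structures.
From mathcomp Require Import all_boot all_order all_algebra.
From mathcomp Require Import all_classical all_reals all_analysis.
From mathcomp Require Import lra.

Set Implicit Arguments.
Unset Strict Implicit.
Unset Printing Implicit Defensive.

Import Order.TTheory GRing.Theory Num.Theory.
Import numFieldNormedType.Exports.

Local Open Scope classical_set_scope.
Local Open Scope ring_scope.

(** The norm on [R * R] is the sup norm, so a bounded set lies in a square, a product of two compact
    segments; closedness then passes compactness on to [A]. *)
Lemma bounded_closed_prod_compact (R : realType) (A : set (R * R)) :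
  bounded_set A -> closed A -> compact A.
Proof.
move=> [M [_ AM]] Acl; pose I : set R := `[- (M + 1), M + 1]%classic.
have box_compact : compact (I `*` I).
  by apply: compact_setX; exact: segment_compact.
(* Boundedness only guarantees the radii strictly above [M], hence [M + 1]. *)
apply: (subclosed_compact Acl box_compact) => -[x y] /(AM (M + 1)).
rewrite ltrDl ltr01 => /(_ isT); rewrite /= prod_normE ge_max => /andP[xM yM].
by rewrite /I /= !in_itv /= -!ler_norml.
Qed.

Section maximizers.
Context (R : realType) (S : set (R * R)) (f : R -> R) (g : R * R -> R).
Hypotheses (f_cont : continuous f) (g_cont : continuous g).

Lemma continuous_objective (lambda : R) : continuous (objective f g lambda).
Proof.
move=> p; apply: cvgD; last exact: g_cont.
apply: cvgM; first exact: cvg_cst.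
by apply: continuous_comp; [exact: cvg_fst|exact: f_cont].
Qed.

Hypotheses (S_nonempty : S !=set0) (S_compact : compact S).

Lemma maximizers_nonempty (lambda : R) : maximizers S f g lambda !=set0.
Proof.
have [c /set_mem Sc c_max] := compact_EVT_max S_nonempty S_compact
  (continuous_subspaceT (@continuous_objective lambda)).
by exists c; split => // q /mem_set /c_max.
Qed.

(** Once the optimal value [v] is attained, being optimal amounts to lying in [S] with objective at
    least [v]: a closed condition on a compact set. *)
Lemma compact_maximizers (lambda : R) : compact (maximizers S f g lambda).
Proof.
have [c [Sc c_max]] := maximizers_nonempty lambda.
pose v := objective f g lambda c.
have -> : maximizers S f g lambda =
    S `&` objective f g lambda @^-1` [set x | v <= x].
  apply/seteqP; split => [p [Sp p_max]|p [Sp vp]].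
    by split => //; exact: p_max.
  by split => // q /c_max /le_trans; exact.
apply: compact_closedI => //; apply: preimage_closed; last exact: closed_ge.
by move=> p _; exact: continuous_objective.
Qed.

(** The first projection is continuous, so it attains its maximum on the nonempty compact set of
    maximizers; this existence is what makes the value chosen by [get] meaningful. *)
Lemma xstar_maxP (lambda : R) :
  is_max (xstar S f g lambda) (xstar_max S f g lambda).
Proof.
apply: getPex.
have fst_cont : continuous (fst : R * R -> R) by move=> p; exact: cvg_fst.
have [[x y] /set_mem Mxy x_max] := compact_EVT_max (maximizers_nonempty lambda)
  (@compact_maximizers lambda) (continuous_subspaceT fst_cont).
by exists x; split => [|z [w /mem_set /x_max]//]; exists y.
Qed.

Lemma xstar_minP (lambda : R) :
  is_min (xstar S f g lambda) (xstar_min S f g lambda).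
Proof.
apply: getPex.
have fst_cont : continuous (fst : R * R -> R) by move=> p; exact: cvg_fst.
have [[x y] /set_mem Mxy x_min] := compact_EVT_min (maximizers_nonempty lambda)
  (@compact_maximizers lambda) (continuous_subspaceT fst_cont).
by exists x; split => [|z [w /mem_set /x_min]//]; exists y.
Qed.

End maximizers.

Lemma f_xstar_nondecreasing (R : realType) (S : set (R * R)) (f : R -> R)
    (g : R * R -> R) (lambda1 lambda2 x1 x2 : R) :
  lambda1 < lambda2 -> xstar S f g lambda1 x1 -> xstar S f g lambda2 x2 ->
  f x1 <= f x2.
Proof.
move=> lt12 [y1 [S1 max1]] [y2 [S2 max2]].
move: (max1 _ S2) (max2 _ S1); rewrite /objective /= => le1 le2.
(* After scaling by the positive gap [lambda2 - lambda1], the goal is the sum of [le1] and [le2],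
   linear once the products of a parameter and a value of [f] count as atoms. *)
rewrite -(ler_pM2l (x := lambda2 - lambda1)) ?subr_gt0//; lra.
Qed.

Theorem corollary2 (R : realType) (S : set (R * R)) (f : R -> R)
    (g : R * R -> R)
    (S_nonempty : S !=set0) (S_closed : closed S) (S_bounded : bounded_set S)
    (f_cont : continuous f) (g_cont : continuous g)
    (f_decr : forall x y : R, x < y -> f y < f x) :
  forall lambda1 lambda2 : R, 0 <= lambda1 -> lambda1 < lambda2 ->
    xstar_max S f g lambda2 <= xstar_min S f g lambda1.
Proof.
move=> lambda1 lambda2 _ lt12.
have S_compact := bounded_closed_prod_compact S_bounded S_closed.
have [max_in _] := xstar_maxP f_cont g_cont S_nonempty S_compact lambda2.
have [min_in _] := xstar_minP f_cont g_cont S_nonempty S_compact lambda1.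
have := f_xstar_nondecreasing lt12 min_in max_in.
(* Strict decrease is used contrapositively: the reverse strict order of the two extrema would
   reverse the inequality between their images under [f]. *)
by apply: contraTT; rewrite -!ltNge; exact: f_decr.
Qed.
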